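(* Let $R=R_1\times\cdots\times R_t$ be a finite direct product of commutative rings with identity, and for each $i$ let $\pi_i:R_1\times\cdots\times R_t\to R_i$ be the projection onto the $i$th factor. Then $\pi_i$ is also the structural morphism making $R_i$ an $R$-algebra, and for any $R$-modules $M_1,M_2,N$ and any given pair of $R$-linear maps $f_j:M_j\to N$, $j=1,2$, one has an isomorphism (of $R$-modules) $$\ker(f_1\mid f_2)\cong\bigoplus_{i=1}^{t}\ker(\pi_i^{\ast}(f_1)\mid\pi_i^{\ast}(f_2)).$$
   Context: For linear maps $f_1:M_1\to N$ and $f_2:M_2\to N$ of modules over a commutative ring, the kernel of the pair is the submodule of $M_2$ given by $\ker(f_1\mid f_2)=\{m_2\in M_2 \mid \exists m_1\in M_1 : f_1(m_1)+f_2(m_2)=0\}$. For an $R$-module $M$, $\pi_i^{\ast}(M)=M\otimes_R R_i$ (with $R_i$ an $R$-algebra via $\pi_i$), and for an $R$-linear map $f:M\to N$, $\pi_i^{\ast}(f)=f\otimes\mathbf{I}_{R_i}:M\otimes_R R_i\to N\otimes_R R_i$. Each $R_i$-module is regarded as an $R$-module via $\pi_i$. *)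

(* Defs.v *)
From HB Require Import structures.
From mathcomp Require Import all_boot all_algebra.
From mathcomp Require Import boolp.
From mathcomp Require Import freeg.

Set Implicit Arguments.
Unset Strict Implicit.
Unset Printing Implicit Defensive.

Import GRing.Theory.
Local Open Scope ring_scope.
Local Open Scope quotient_scope.

(* Rings are [comPzRingType], so that the zero ring is allowed as a factor.
   MathComp's [comAlgType] excludes it; an R-algebra S is therefore presented
   by its structural morphism [phi : {rmorphism R -> S}]. *)

Definition prodring (I : finType) (R_ : I -> comPzRingType) : Type :=
  {dffun forall i, R_ i}.

Section ProdRing.
Variables (I : finType) (R_ : I -> comPzRingType).
Local Notation P := (prodring R_).

HB.instance Definition _ := Choice.copy P {dffun forall i, R_ i}.

Definition prod_zero : P := [ffun i => 0 : R_ i].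
Definition prod_one : P := [ffun i => 1 : R_ i].
Definition prod_opp (x : P) : P := [ffun i => - x i : R_ i].
Definition prod_add (x y : P) : P := [ffun i => x i + y i : R_ i].
Definition prod_mul (x y : P) : P := [ffun i => x i * y i : R_ i].

Fact prod_addA : associative prod_add.
Proof. by move=> x y z; apply/ffunP=> i; rewrite !ffunE addrA. Qed.
Fact prod_addC : commutative prod_add.
Proof. by move=> x y; apply/ffunP=> i; rewrite !ffunE addrC. Qed.
Fact prod_add0 : left_id prod_zero prod_add.
Proof. by move=> x; apply/ffunP=> i; rewrite !ffunE add0r. Qed.
Fact prod_addN : left_inverse prod_zero prod_opp prod_add.
Proof. by move=> x; apply/ffunP=> i; rewrite !ffunE addNr. Qed.
Fact prod_mulA : associative prod_mul.
Proof. by move=> x y z; apply/ffunP=> i; rewrite !ffunE mulrA. Qed.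
Fact prod_mulC : commutative prod_mul.
Proof. by move=> x y; apply/ffunP=> i; rewrite !ffunE mulrC. Qed.
Fact prod_mul1 : left_id prod_one prod_mul.
Proof. by move=> x; apply/ffunP=> i; rewrite !ffunE mul1r. Qed.
Fact prod_mulDl : left_distributive prod_mul prod_add.
Proof. by move=> x y z; apply/ffunP=> i; rewrite !ffunE mulrDl. Qed.

HB.instance Definition _ :=
  GRing.isZmodule.Build P prod_addA prod_addC prod_add0 prod_addN.
HB.instance Definition _ :=
  GRing.Zmodule_isComPzRing.Build P prod_mulA prod_mulC prod_mul1 prod_mulDl.

Definition proj (i : I) (x : P) : R_ i := x i.

Fact proj_is_zmod_morphism i : zmod_morphism (proj i).
Proof. by move=> x y; rewrite /proj !ffunE. Qed.
Fact proj_is_monoid_morphism i : monoid_morphism (proj i).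
Proof. by split=> [|x y]; rewrite /proj !ffunE. Qed.

HB.instance Definition _ i :=
  GRing.isZmodMorphism.Build P (R_ i) (proj i) (proj_is_zmod_morphism i).
HB.instance Definition _ i :=
  GRing.isMonoidMorphism.Build P (R_ i) (proj i) (proj_is_monoid_morphism i).

End ProdRing.

Arguments proj {I} R_ i x.

(* Over a finite index set every family has finite support. *)
Definition dirsum (R : pzRingType) (I : finType) (M : I -> lmodType R) : Type :=
  {dffun forall i, M i}.

Section DirSum.
Variables (R : pzRingType) (I : finType) (M : I -> lmodType R).
Local Notation D := (dirsum M).

HB.instance Definition _ := Choice.copy D {dffun forall i, M i}.

Definition dirsum_zero : D := [ffun i => 0 : M i].
Definition dirsum_opp (x : D) : D := [ffun i => - x i : M i].
Definition dirsum_add (x y : D) : D := [ffun i => x i + y i : M i].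
Definition dirsum_scale (a : R) (x : D) : D := [ffun i => a *: x i : M i].

Fact dirsum_addA : associative dirsum_add.
Proof. by move=> x y z; apply/ffunP=> i; rewrite !ffunE addrA. Qed.
Fact dirsum_addC : commutative dirsum_add.
Proof. by move=> x y; apply/ffunP=> i; rewrite !ffunE addrC. Qed.
Fact dirsum_add0 : left_id dirsum_zero dirsum_add.
Proof. by move=> x; apply/ffunP=> i; rewrite !ffunE add0r. Qed.
Fact dirsum_addN : left_inverse dirsum_zero dirsum_opp dirsum_add.
Proof. by move=> x; apply/ffunP=> i; rewrite !ffunE addNr. Qed.

HB.instance Definition _ :=
  GRing.isZmodule.Build D dirsum_addA dirsum_addC dirsum_add0 dirsum_addN.

Fact dirsum_scaleA a b x :
  dirsum_scale a (dirsum_scale b x) = dirsum_scale (a * b) x.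
Proof. by apply/ffunP=> i; rewrite !ffunE scalerA. Qed.
Fact dirsum_scale1 : left_id 1 dirsum_scale.
Proof. by move=> x; apply/ffunP=> i; rewrite !ffunE scale1r. Qed.
Fact dirsum_scaleDr : right_distributive dirsum_scale +%R.
Proof. by move=> a x y; apply/ffunP=> i; rewrite !ffunE scalerDr. Qed.
Fact dirsum_scaleDl x : {morph dirsum_scale^~ x : a b / a + b}.
Proof. by move=> a b; apply/ffunP=> i; rewrite !ffunE scalerDl. Qed.

HB.instance Definition _ := GRing.Zmodule_isLmodule.Build R D
  dirsum_scaleA dirsum_scale1 dirsum_scaleDr dirsum_scaleDl.

End DirSum.

Definition restr (R S : pzRingType) (phi : {rmorphism R -> S})
  (M : lmodType S) : Type := M.

Section Restr.
Variables (R S : pzRingType) (phi : {rmorphism R -> S}) (M : lmodType S).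
Local Notation T := (restr phi M).

HB.instance Definition _ := GRing.Zmodule.copy T M.

Definition restr_scale (a : R) (x : T) : T := phi a *: (x : M).

Fact restr_scaleA a b x :
  restr_scale a (restr_scale b x) = restr_scale (a * b) x.
Proof. by rewrite /restr_scale scalerA rmorphM. Qed.
Fact restr_scale1 : left_id 1 restr_scale.
Proof. by move=> x; rewrite /restr_scale rmorph1 scale1r. Qed.
Fact restr_scaleDr : right_distributive restr_scale +%R.
Proof. by move=> a x y; rewrite /restr_scale scalerDr. Qed.
Fact restr_scaleDl x : {morph restr_scale^~ x : a b / a + b}.
Proof. by move=> a b; rewrite /restr_scale rmorphD scalerDl. Qed.

HB.instance Definition _ := GRing.Zmodule_isLmodule.Build R T
  restr_scaleA restr_scale1 restr_scaleDr restr_scaleDl.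

End Restr.

(* The subgroup of the free abelian group on [M * N] generated by the
   bilinearity relations. *)
Inductive tensor_rel (R : comPzRingType) (M N : lmodType R) :
    {freeg (M * N) / int} -> Prop :=
| tensor_rel0 : tensor_rel 0
| tensor_relB x y : tensor_rel x -> tensor_rel y -> tensor_rel (x - y)
| tensor_relDl m m' n : tensor_rel (<<(m + m', n)>> - <<(m, n)>> - <<(m', n)>>)
| tensor_relDr m n n' : tensor_rel (<<(m, n + n')>> - <<(m, n)>> - <<(m, n')>>)
| tensor_relZ a m n : tensor_rel (<<(a *: m, n)>> - <<(m, a *: n)>>).

Definition tensor_sub (R : comPzRingType) (M N : lmodType R)
    (x : {freeg (M * N) / int}) : bool := `[< tensor_rel x >].

Fact tensor_sub_closed (R : comPzRingType) (M N : lmodType R) :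
  zmod_closed (@tensor_sub R M N).
Proof.
split; first by apply/asboolP; exact: tensor_rel0.
by move=> x y /asboolP Hx /asboolP Hy; apply/asboolP; exact: tensor_relB.
Qed.
HB.instance Definition _ (R : comPzRingType) (M N : lmodType R) :=
  GRing.isZmodClosed.Build _ (@tensor_sub R M N) (@tensor_sub_closed R M N).

Definition tensor_subgroup (R : comPzRingType) (M N : lmodType R) :
    zmodClosed {freeg (M * N) / int} :=
  GRing.ZmodClosed.clone _ (@tensor_sub R M N) _.

Definition tensor (R : comPzRingType) (M N : lmodType R) : Type :=
  Quotient.quot (tensor_subgroup M N).

HB.instance Definition _ (R : comPzRingType) (M N : lmodType R) :=
  GRing.Zmodule.copy (tensor M N) (Quotient.quot (tensor_subgroup M N)).

Definition tensor_pi (R : comPzRingType) (M N : lmodType R)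
    (D : {freeg (M * N) / int}) : tensor M N :=
  \pi_(Quotient.quot (tensor_subgroup M N)) D.

Definition pure (R : comPzRingType) (M N : lmodType R) (m : M) (n : N) :
    tensor M N := tensor_pi <<(m, n)>>.

Definition balanced (R : comPzRingType) (M N : lmodType R) (P : zmodType)
    (b : M -> N -> P) : Prop :=
  [/\ forall m m' n, b (m + m') n = b m n + b m' n,
      forall m n n', b m (n + n') = b m n + b m n' &
      forall a m n, b (a *: m) n = b m (a *: n)].

(* [zmodule P] is P as a module over the integers. *)
Definition freeg_lift (K : choiceType) (P : zmodType) (h : K -> P) :
  {freeg K / int} -> P := @fglift int (zmodule P) K h.

Fact freeg_lift_is_zmod_morphism (K : choiceType) (P : zmodType) (h : K -> P) :
  zmod_morphism (freeg_lift h).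
Proof. exact: (@lift_is_additive int K (zmodule P)). Qed.
HB.instance Definition _ (K : choiceType) (P : zmodType) (h : K -> P) :=
  GRing.isZmodMorphism.Build _ _ (freeg_lift h)
    (freeg_lift_is_zmod_morphism h).

Lemma freeg_liftU (K : choiceType) (P : zmodType) (h : K -> P) x :
  freeg_lift h <<x>> = h x.
Proof. by rewrite /freeg_lift liftU scale1r. Qed.

(* Depends on the choice of a representative unless [b] is balanced. *)
Definition tensor_lift (R : comPzRingType) (M N : lmodType R) (P : zmodType)
    (b : M -> N -> P) (x : tensor M N) : P :=
  freeg_lift (fun mn => b mn.1 mn.2)
             (repr (x : Quotient.quot (tensor_subgroup M N))).

Section TensorTheory.
Variables (R : comPzRingType) (M N : lmodType R).
Implicit Types (P : zmodType).
Local Notation T := (Quotient.quot (tensor_subgroup M N)).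

Fact tensor_pi_is_zmod_morphism : zmod_morphism (@tensor_pi R M N).
Proof. by move=> x y; exact: (raddfB (\pi_T)). Qed.
HB.instance Definition _ := GRing.isZmodMorphism.Build _ _ (@tensor_pi R M N)
  tensor_pi_is_zmod_morphism.

Lemma tensor_pi_eq0 D : tensor_rel D -> tensor_pi D = 0 :> tensor M N.
Proof.
move=> HD; rewrite -(raddf0 (@tensor_pi R M N)); apply/eqP.
by rewrite /tensor_pi -Quotient.idealrBE subr0; apply/asboolP.
Qed.

Lemma tensor_pi_repr (x : tensor M N) : tensor_pi (repr (x : T)) = x.
Proof. exact: (reprK (x : T)). Qed.

Lemma pureDl (m m' : M) (n : N) : pure (m + m') n = pure m n + pure m' n.
Proof.
apply/eqP; rewrite -subr_eq0 opprD addrA /pure -!raddfB /=.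
by rewrite tensor_pi_eq0 //; exact: tensor_relDl.
Qed.

Lemma pureDr (m : M) (n n' : N) : pure m (n + n') = pure m n + pure m n'.
Proof.
apply/eqP; rewrite -subr_eq0 opprD addrA /pure -!raddfB /=.
by rewrite tensor_pi_eq0 //; exact: tensor_relDr.
Qed.

Lemma pureZ a (m : M) (n : N) : pure (a *: m) n = pure m (a *: n).
Proof.
apply/eqP; rewrite -subr_eq0 /pure -!raddfB /=.
by rewrite tensor_pi_eq0 //; exact: tensor_relZ.
Qed.

Lemma tensor_lift_pi P (b : M -> N -> P) D : balanced b ->
  tensor_lift b (tensor_pi D) = freeg_lift (fun mn => b mn.1 mn.2) D.
Proof.
case=> bDl bDr bZ; apply/eqP; rewrite -subr_eq0 /tensor_lift.
rewrite -raddfB /=.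
have: tensor_rel (repr (\pi_T D) - D).
  apply/asboolP; change (repr (\pi_T D) - D \in tensor_subgroup M N).
  by rewrite Quotient.idealrBE reprK.
elim=> [|x y _ /eqP IHx _ /eqP IHy|m m' n|m n n'|a m n].
- by rewrite raddf0.
- by rewrite raddfB /= IHx IHy subrr.
- by rewrite !raddfB /= !freeg_liftU /= bDl [_ + b m' n]addrC addrK subrr.
- by rewrite !raddfB /= !freeg_liftU /= bDr [_ + b m n']addrC addrK subrr.
- by rewrite raddfB /= !freeg_liftU /= bZ subrr.
Qed.

Lemma tensor_lift_pure P (b : M -> N -> P) m n : balanced b ->
  tensor_lift b (pure m n) = b m n.
Proof. by move=> Hb; rewrite /pure tensor_lift_pi // freeg_liftU. Qed.

Lemma tensor_liftB P (b : M -> N -> P) : balanced b ->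
  {morph tensor_lift b : x y / x - y}.
Proof.
move=> Hb x y; rewrite -(tensor_pi_repr x) -(tensor_pi_repr y).
by rewrite -raddfB !tensor_lift_pi // raddfB.
Qed.

Lemma tensor_ind (Q : tensor M N -> Prop) :
  (forall x y, Q x -> Q y -> Q (x - y)) ->
  (forall m n, Q (pure m n)) -> forall x, Q x.
Proof.
move=> QB Qp x.
have Q0 : Q 0 by rewrite -(subrr (pure 0 0)); apply: QB.
have QD y z : Q y -> Q z -> Q (y + z).
  by move=> Qy Qz; rewrite -[z]opprK -[- z]sub0r; apply: (QB) => //; exact: QB.
rewrite -[x]tensor_pi_repr -(freeg_sumE (repr _)) raddf_sum /=.
apply: (big_ind Q) => // [[m n]] _.
elim/int_ind: (coeff _ _) => [|k IH|k IH].
- by rewrite freegU0 raddf0.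
- by rewrite -addn1 PoszD -freegUD raddfD; apply: QD => //; exact: Qp.
- by rewrite -addn1 PoszD opprD -freegUB raddfB; apply: QB => //; exact: Qp.
Qed.

Lemma eq_tensor P (f g : tensor M N -> P) :
  {morph f : x y / x - y} -> {morph g : x y / x - y} ->
  (forall m n, f (pure m n) = g (pure m n)) -> f =1 g.
Proof.
move=> fB gB fg; elim/tensor_ind=> [x y e1 e2|//].
by rewrite fB gB e1 e2.
Qed.

End TensorTheory.

Section TensorModule.
Variables (R : comPzRingType) (M N : lmodType R).
Local Notation T := (tensor M N).

Definition tensor_scale (a : R) : T -> T :=
  tensor_lift (fun m n => pure (a *: m) n).

Fact tensor_scale_balanced a : balanced (fun (m : M) (n : N) => pure (a *: m) n).
Proof.
split=> [m m' n|m n n'|c m n]; first by rewrite scalerDr pureDl.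
  by rewrite pureDr.
by rewrite -pureZ !scalerA mulrC.
Qed.
Let bal := tensor_scale_balanced.

Lemma tensor_scale_pure a (m : M) (n : N) :
  tensor_scale a (pure m n) = pure (a *: m) n.
Proof. by rewrite /tensor_scale tensor_lift_pure. Qed.

Fact tensor_scaleB a : {morph tensor_scale a : x y / x - y}.
Proof. exact: tensor_liftB. Qed.
Fact tensor_scaleA a b x :
  tensor_scale a (tensor_scale b x) = tensor_scale (a * b) x.
Proof.
move: x; apply: eq_tensor => [x y|x y|m n]; rewrite ?tensor_scaleB //.
by rewrite !tensor_scale_pure scalerA.
Qed.
Fact tensor_scale1 : left_id 1 tensor_scale.
Proof.
apply: eq_tensor => [x y|x y|m n] //; rewrite ?tensor_scaleB //.
by rewrite tensor_scale_pure scale1r.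
Qed.
Fact tensor_scaleDr : right_distributive tensor_scale +%R.
Proof.
move=> a x y; have sN z : tensor_scale a (- z) = - tensor_scale a z.
  by rewrite -[- z]sub0r -{1}(subrr z) !tensor_scaleB subrr sub0r.
by rewrite -[y in LHS]opprK tensor_scaleB sN opprK.
Qed.
Fact tensor_scaleDl x : {morph tensor_scale^~ x : a b / a + b}.
Proof.
move=> a b; move: x; apply: eq_tensor => [x y|x y|m n].
- by rewrite tensor_scaleB.
- by rewrite !tensor_scaleB opprD addrACA.
- by rewrite !tensor_scale_pure scalerDl pureDl.
Qed.

HB.instance Definition _ := GRing.Zmodule_isLmodule.Build R T
  tensor_scaleA tensor_scale1 tensor_scaleDr tensor_scaleDl.

Lemma scale_pure a (m : M) (n : N) : a *: pure m n = pure (a *: m) n.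
Proof. exact: tensor_scale_pure. Qed.

End TensorModule.

Section TensorMap.
Variables (R : comPzRingType) (M M' N N' : lmodType R).
Variables (f : {linear M -> M'}) (g : {linear N -> N'}).

Definition tensor_map : tensor M N -> tensor M' N' :=
  tensor_lift (fun m n => pure (f m) (g n)).

Fact tensor_map_balanced : balanced (fun m n => pure (f m) (g n)).
Proof.
by split=> [m m' n|m n n'|a m n]; rewrite ?linearD ?pureDl ?pureDr ?linearZ ?pureZ.
Qed.

Lemma tensor_map_pure m n : tensor_map (pure m n) = pure (f m) (g n).
Proof. by rewrite /tensor_map tensor_lift_pure //; exact: tensor_map_balanced. Qed.

Fact tensor_map_is_zmod_morphism : zmod_morphism tensor_map.
Proof. exact/tensor_liftB/tensor_map_balanced. Qed.
HB.instance Definition _ :=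
  GRing.isZmodMorphism.Build _ _ tensor_map tensor_map_is_zmod_morphism.

Fact tensor_map_is_scalable : scalable tensor_map.
Proof.
move=> a; apply: eq_tensor => [x y|x y|m n]; rewrite ?(raddfB, scalerBr) //.
by rewrite scale_pure !tensor_map_pure scale_pure linearZ.
Qed.
HB.instance Definition _ :=
  GRing.isScalable.Build R _ _ _ tensor_map tensor_map_is_scalable.

End TensorMap.

(* The S-module of a tensor product of M with the R-algebra S; the R-algebra
   structure of S is the one given by [phi]. *)
Definition ext (R S : comPzRingType) (phi : {rmorphism R -> S})
  (M : lmodType R) : Type := tensor M (restr phi S^o).

Section Ext.
Variables (R S : comPzRingType) (phi : {rmorphism R -> S}).

Section Mul.
Variable s : S.
Definition restr_mul (x : restr phi S^o) : restr phi S^o := (s : S) * (x : S).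

Fact restr_mul_is_zmod_morphism : zmod_morphism restr_mul.
Proof. by move=> x y; exact: mulrBr. Qed.
HB.instance Definition _ :=
  GRing.isZmodMorphism.Build _ _ restr_mul restr_mul_is_zmod_morphism.
Fact restr_mul_is_scalable : scalable restr_mul.
Proof. by move=> a x; exact: (mulrCA (s : S) (phi a) (x : S)). Qed.
HB.instance Definition _ :=
  GRing.isScalable.Build R _ _ _ restr_mul restr_mul_is_scalable.
End Mul.

Variable M : lmodType R.
Local Notation T := (ext phi M).

HB.instance Definition _ := GRing.Zmodule.copy T (tensor M (restr phi S^o)).

Definition ext_scale (s : S) : T -> T := tensor_map idfun (restr_mul s).

Fact ext_scaleB s : {morph ext_scale s : x y / x - y}.
Proof. exact: raddfB. Qed.
Fact ext_scale_pure s m x :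
  ext_scale s (pure m x) = pure m (restr_mul s x).
Proof. exact: tensor_map_pure. Qed.

Fact ext_scaleA s t x : ext_scale s (ext_scale t x) = ext_scale (s * t) x.
Proof.
move: x; apply: eq_tensor => [x y|x y|m n]; rewrite ?ext_scaleB //.
by rewrite !ext_scale_pure /restr_mul mulrA.
Qed.
Fact ext_scale1 : left_id 1 ext_scale.
Proof.
apply: eq_tensor => [x y|x y|m n] //; rewrite ?ext_scaleB //.
by rewrite ext_scale_pure /restr_mul mul1r.
Qed.
Fact ext_scaleDr : right_distributive ext_scale +%R.
Proof. by move=> s x y; exact: raddfD. Qed.
Fact ext_scaleDl x : {morph ext_scale^~ x : s t / s + t}.
Proof.
move=> s t; move: x; apply: eq_tensor => [x y|x y|m n].
- by rewrite ext_scaleB.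
- by rewrite !ext_scaleB opprD addrACA.
- by rewrite !ext_scale_pure /restr_mul mulrDl -pureDr.
Qed.

HB.instance Definition _ := GRing.Zmodule_isLmodule.Build S T
  ext_scaleA ext_scale1 ext_scaleDr ext_scaleDl.

(* Regarding the S-module [ext phi M] as an R-module through [phi] gives back
   the R-module structure of the tensor product. *)
Lemma ext_restrE a (x : tensor M (restr phi S^o)) :
  a *: (x : restr phi T) = a *: x.
Proof.
change (ext_scale (phi a) x = a *: x); move: x.
apply: eq_tensor => [x y|x y|m n]; rewrite ?ext_scaleB ?scalerBr //.
by rewrite ext_scale_pure scale_pure pureZ.
Qed.

End Ext.

Section ExtMap.
Variables (R S : comPzRingType) (phi : {rmorphism R -> S}).
Variables (M N : lmodType R) (f : {linear M -> N}).

Definition ext_map : ext phi M -> ext phi N := tensor_map f idfun.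

Fact ext_map_is_zmod_morphism : zmod_morphism ext_map.
Proof. by move=> x y; exact: raddfB. Qed.
HB.instance Definition _ :=
  GRing.isZmodMorphism.Build _ _ ext_map ext_map_is_zmod_morphism.
Fact ext_map_is_scalable : scalable ext_map.
Proof.
move=> s; apply: eq_tensor => [x y|x y|m n]; rewrite ?(raddfB, scalerBr) //.
change (ext_map (ext_scale s (pure m n)) = ext_scale s (ext_map (pure m n))).
by rewrite ext_scale_pure /ext_map !tensor_map_pure ext_scale_pure.
Qed.
HB.instance Definition _ :=
  GRing.isScalable.Build S _ _ _ ext_map ext_map_is_scalable.

End ExtMap.

Arguments ext_map {R S} phi {M N} f x.

Section PairKer.
Variables (R : comPzRingType) (M1 M2 N : lmodType R).
Variables (f1 : {linear M1 -> N}) (f2 : {linear M2 -> N}).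

Definition in_pairker (m2 : M2) : bool :=
  `[< exists m1 : M1, f1 m1 + f2 m2 = 0 >].

Fact in_pairker_closed : submod_closed in_pairker.
Proof.
split; first by apply/asboolP; exists 0; rewrite !linear0 addr0.
move=> a x y /asboolP[u eu] /asboolP[v ev]; apply/asboolP; exists (a *: u + v).
by rewrite !linearP addrACA -scalerDr eu ev scaler0 addr0.
Qed.
HB.instance Definition _ :=
  GRing.isSubmodClosed.Build R M2 in_pairker in_pairker_closed.

Record pairker : Type :=
  PairKer { pairker_val : M2; _ : pairker_val \in in_pairker }.

HB.instance Definition _ := [isSub for pairker_val].
HB.instance Definition _ := [Choice of pairker by <:].
HB.instance Definition _ := [SubChoice_isSubLmodule of pairker by <:].

End PairKer.

(* Main.v *)
From HB Require Import structures.
Require Import Defs.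
From mathcomp Require Import all_boot all_algebra.
From mathcomp Require Import boolp.
Import GRing.Theory.
Local Open Scope ring_scope.

(** Write R for the product ring and e_i for its idempotent that is 1 at i and
    0 elsewhere.  Tensoring an R-module M with R_i only cuts out the summand
    e_i M: the maps [m |-> m (x) 1] (here [unit_ext]) and
    [m (x) s |-> (0,..,s,..,0) m] (here [collapse]) restrict to mutually inverse
    isomorphisms between e_i M and its i-th base change ([unit_collapse] and
    [collapse_unit]).  Both are natural in M, so each carries a witness
    [f1 m1 + f2 m2 = 0] to a witness of the same kind and hence maps one kernel
    of a pair into the other.

    Because the e_i sum to 1 and are orthogonal, m is the sum of its
    components e_i m ([sum_collapse_unit]), while the j-th base change of e_i M
    vanishes for j different from i ([unit_collapse_neq]).  Therefore
    [m |-> (m (x) 1)_i] and [(y_i)_i |-> sum_i collapse y_i] are inverse to each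
    other on the kernels, exactly as on the ambient modules. *)

(** * The factors of a product ring *)

Section Factors.
Variables (I : finType) (R_ : I -> comPzRingType).
Local Notation P := (prodring R_).

Definition factor_in (i : I) (s : R_ i) : P :=
  [ffun j => dfwith (fun k => 0 : R_ k) s j].

Lemma factor_in_at i (s : R_ i) : proj R_ i (factor_in i s) = s.
Proof. by rewrite /proj ffunE dfwith_in. Qed.

Lemma factor_in_out i j (s : R_ i) : i != j -> proj R_ j (factor_in i s) = 0.
Proof. by move=> ij; rewrite /proj ffunE dfwith_out. Qed.

Lemma prodringP (a b : P) : (forall i, proj R_ i a = proj R_ i b) -> a = b.
Proof. by move=> ab; apply/ffunP. Qed.

Lemma projM i (a b : P) : proj R_ i (a * b) = proj R_ i a * proj R_ i b.
Proof. exact: rmorphM. Qed.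

Lemma projD i (a b : P) : proj R_ i (a + b) = proj R_ i a + proj R_ i b.
Proof. exact: raddfD. Qed.

(** The embedding of a factor is linear over the product ring although it does
    not preserve 1; this is what makes [collapse] balanced. *)
Lemma factor_inM i a (s : R_ i) :
  a * factor_in i s = factor_in i (proj R_ i a * s).
Proof.
apply: prodringP => j; rewrite projM.
have [ij|ij] := eqVneq i j; first by case: j / ij; rewrite !factor_in_at.
by rewrite !factor_in_out // mulr0.
Qed.

Lemma factor_inD i (s s' : R_ i) :
  factor_in i (s + s') = factor_in i s + factor_in i s'.
Proof.
apply: prodringP => j; rewrite projD.
have [ij|ij] := eqVneq i j; first by case: j / ij; rewrite !factor_in_at.
by rewrite !factor_in_out // addr0.
Qed.

Lemma sum_factor_in1 : \sum_i factor_in i 1 = 1.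
Proof.
apply: prodringP => j.
rewrite [LHS](raddf_sum (proj R_ j)) [RHS](rmorph1 (proj R_ j)).
rewrite (bigD1 j) //= [X in X + _]factor_in_at big1 ?addr0 // => i ij.
exact: factor_in_out.
Qed.

End Factors.

Arguments factor_in {I R_} i s.
Arguments factor_in_at {I} R_ i s.
Arguments factor_in_out {I} R_ i j s _.

(** * Base change to a factor as a direct summand *)

Section UnitExt.
Variables (R S : comPzRingType) (phi : {rmorphism R -> S}) (M : lmodType R).

(** The unit of extension and restriction of scalars; the target is restricted
    along [phi] so that the map is linear over R. *)
Definition unit_ext (m : M) : restr phi (ext phi M) :=
  pure m (1 : restr phi S^o).

Fact unit_ext_is_zmod_morphism : zmod_morphism unit_ext.
Proof. by move=> x y; apply: (canRL (addrK _)); rewrite -pureDl subrK. Qed.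
HB.instance Definition _ :=
  GRing.isZmodMorphism.Build _ _ unit_ext unit_ext_is_zmod_morphism.

Fact unit_ext_is_scalable : scalable unit_ext.
Proof. by move=> a x; rewrite ext_restrE scale_pure. Qed.
HB.instance Definition _ :=
  GRing.isScalable.Build R _ _ _ unit_ext unit_ext_is_scalable.

Lemma unit_extZ a m :
  unit_ext (a *: m) = pure m (phi a : restr phi S^o).
Proof. by rewrite /unit_ext pureZ; congr (pure m _); exact: mulr1. Qed.

End UnitExt.

Arguments unit_ext {R S} phi {M} m.

Lemma ext_map_unit (R S : comPzRingType) (phi : {rmorphism R -> S})
    (M N : lmodType R) (f : {linear M -> N}) (m : M) :
  ext_map phi f (unit_ext phi m) = unit_ext phi (f m).
Proof. exact: tensor_map_pure. Qed.

Section Collapse.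
Variables (I : finType) (R_ : I -> comPzRingType).
Local Notation P := (prodring R_).
Variable M : lmodType P.

Definition collapse (i : I) : ext (proj R_ i) M -> M :=
  tensor_lift (fun m (s : restr (proj R_ i) (R_ i)^o) =>
                 factor_in i (s : R_ i) *: m).

Fact collapse_balanced i :
  balanced (fun (m : M) (s : restr (proj R_ i) (R_ i)^o) =>
              factor_in i (s : R_ i) *: m).
Proof.
split=> [m m' s|m s s'|a m s]; first by rewrite scalerDr.
  by rewrite -scalerDl -factor_inD.
by rewrite scalerA mulrC factor_inM.
Qed.

Lemma collapse_pure i (m : M) (s : R_ i) :
  collapse i (pure m (s : restr (proj R_ i) (R_ i)^o)) = factor_in i s *: m.
Proof. by rewrite /collapse tensor_lift_pure //; exact: collapse_balanced. Qed.

Fact collapse_is_zmod_morphism i : zmod_morphism (collapse i).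
Proof. exact/tensor_liftB/collapse_balanced. Qed.
HB.instance Definition _ i :=
  GRing.isZmodMorphism.Build _ _ (collapse i) (collapse_is_zmod_morphism i).

Lemma collapse_unit i (m : M) :
  collapse i (unit_ext (proj R_ i) m) = factor_in i 1 *: m.
Proof. exact: collapse_pure. Qed.

Lemma sum_collapse_unit (m : M) :
  \sum_i collapse i (unit_ext (proj R_ i) m) = m.
Proof.
under eq_bigr do rewrite collapse_unit.
by rewrite -scaler_suml sum_factor_in1 scale1r.
Qed.

(** On pure tensors, the scalar [(0,..,s,..,0)] moves across the tensor sign
    and acts on the factor at j through its j-th component, which is s when
    j = i and 0 otherwise. *)
Lemma unit_collapse i (x : ext (proj R_ i) M) :
  unit_ext (proj R_ i) (collapse i x) = x.
Proof.
move: x; apply: eq_tensor => [x y|//|m s]; first by rewrite !raddfB.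
rewrite collapse_pure unit_extZ; congr (pure m _).
exact: (factor_in_at R_ i s).
Qed.

Lemma unit_collapse_neq i j (x : ext (proj R_ i) M) : i != j ->
  unit_ext (proj R_ j) (collapse i x) = 0.
Proof.
move=> ij; move: x.
apply: (@eq_tensor _ _ _ _ _ (fun=> 0)) => [x y|x y|m s].
- by rewrite !raddfB.
- by rewrite subrr.
rewrite collapse_pure unit_extZ.
transitivity (pure m (0 : restr (proj R_ j) (R_ j)^o)).
  by congr (pure m _); exact: (factor_in_out R_ i j s ij).
by apply: (addrI (pure m 0)); rewrite addr0 -pureDr addr0.
Qed.

Lemma unit_sum_collapse (y : forall i, ext (proj R_ i) M) j :
  unit_ext (proj R_ j) (\sum_i collapse i (y i)) = y j.
Proof.
rewrite raddf_sum /= (bigD1 j) //= unit_collapse big1 ?addr0 // => i ij.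
exact: unit_collapse_neq.
Qed.

End Collapse.

Arguments collapse {I R_ M} i x.

Lemma collapse_ext_map (I : finType) (R_ : I -> comPzRingType)
    (M N : lmodType (prodring R_)) (f : {linear M -> N}) i
    (x : ext (proj R_ i) M) :
  collapse i (ext_map (proj R_ i) f x) = f (collapse i x).
Proof.
move: x; apply: eq_tensor => [x y|x y|m s]; rewrite ?raddfB //.
by rewrite [ext_map _ _ _]tensor_map_pure !collapse_pure linearZ.
Qed.

(** * The isomorphism on kernels of pairs *)

Section PairKerSplit.
Variables (I : finType) (R_ : I -> comPzRingType).
Variables (M1 M2 N : lmodType (prodring R_)).
Variables (f1 : {linear M1 -> N}) (f2 : {linear M2 -> N}).
Local Notation K := (pairker f1 f2).
Local Notation K_ i :=
  (pairker (ext_map (proj R_ i) f1) (ext_map (proj R_ i) f2)).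

Lemma unit_in_pairker i (m : M2) : m \in in_pairker f1 f2 ->
  unit_ext (proj R_ i) m
    \in in_pairker (ext_map (proj R_ i) f1) (ext_map (proj R_ i) f2).
Proof.
case/asboolP=> u fu0; apply/asboolP; exists (unit_ext (proj R_ i) u).
rewrite [X in X + _]ext_map_unit [X in _ + X]ext_map_unit.
by rewrite -[LHS](raddfD (unit_ext (proj R_ i))) fu0 raddf0.
Qed.

Lemma collapse_in_pairker i (x : ext (proj R_ i) M2) :
  x \in in_pairker (ext_map (proj R_ i) f1) (ext_map (proj R_ i) f2) ->
  collapse i x \in in_pairker f1 f2.
Proof.
case/asboolP=> u fu0; apply/asboolP; exists (collapse i u).
by rewrite -!collapse_ext_map -raddfD fu0 raddf0.
Qed.

Definition split_pairker (x : K) :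
    dirsum (fun i => restr (proj R_ i) (K_ i)) :=
  [ffun i => PairKer (unit_in_pairker i _ (valP x))
             : restr (proj R_ i) (K_ i)].

Fact split_pairker_is_zmod_morphism : zmod_morphism split_pairker.
Proof.
move=> x y; apply/ffunP=> i; rewrite !ffunE; apply: val_inj.
exact: (raddfB (unit_ext (proj R_ i))).
Qed.
HB.instance Definition _ := GRing.isZmodMorphism.Build _ _ split_pairker
  split_pairker_is_zmod_morphism.

Fact split_pairker_is_scalable : scalable split_pairker.
Proof.
move=> a x; apply/ffunP=> i; rewrite !ffunE; apply: val_inj.
exact: unit_ext_is_scalable.
Qed.
HB.instance Definition _ := GRing.isScalable.Build _ _ _ _ split_pairker
  split_pairker_is_scalable.

Fact glue_in_pairker (y : dirsum (fun i => restr (proj R_ i) (K_ i))) :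
  \sum_i collapse i (val (y i : K_ i)) \in in_pairker f1 f2.
Proof. by apply: rpred_sum => i _; apply/collapse_in_pairker/valP. Qed.

Definition glue_pairker (y : dirsum (fun i => restr (proj R_ i) (K_ i))) : K :=
  PairKer (glue_in_pairker y).

Lemma split_pairkerK : cancel split_pairker glue_pairker.
Proof.
move=> x; apply: val_inj => /=.
by under eq_bigr do rewrite ffunE /=; exact: sum_collapse_unit.
Qed.

Lemma glue_pairkerK : cancel glue_pairker split_pairker.
Proof.
move=> y; apply/ffunP=> j; rewrite ffunE; apply: val_inj.
exact: (unit_sum_collapse _ _ _ (fun i => val (y i : K_ i))).
Qed.

End PairKerSplit.

Theorem theorem5p1 (t : nat) (R_ : 'I_t -> comPzRingType)
    (M1 M2 N : lmodType (prodring R_))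
    (f1 : {linear M1 -> N}) (f2 : {linear M2 -> N}) :
  (forall (i : 'I_t) (a : prodring R_),
     a *: ((1 : R_ i) : restr (proj R_ i) (R_ i)^o) = proj R_ i a) /\
  exists F : {linear pairker f1 f2 ->
      dirsum (fun i : 'I_t => restr (proj R_ i)
        (pairker (ext_map (proj R_ i) f1) (ext_map (proj R_ i) f2)))},
    bijective F.
Proof.
split=> [i a|]; first exact: mulr1.
exists (@split_pairker _ R_ _ _ _ f1 f2).
by exists (@glue_pairker _ R_ _ _ _ f1 f2);
  [exact: split_pairkerK | exact: glue_pairkerK].
Qed.
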